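(* Let $j$ be a positive integer, let $|q|<1$ and let $w\in\mathbb{C}$. For positive integers $n$ and nonnegative integers $m$, let $P_j(n,m)$ denote the number of partitions of $n$ having exactly $m$ missing integers that are $\geq j$. Then \[ \sum_{n=1}^{\infty}\sum_{m=0}^{\infty} P_j(n,m)w^mq^n=\frac{w^{-j}}{\left(\frac{w-1}{w};q\right)_j}\left(\frac{((w-1)q;q)_{\infty}}{(wq;q)_{\infty}}-\sum_{\ell=0}^{j-1}\frac{\left(\frac{w-1}{w};q\right)_{\ell}}{(q;q)_\ell}(wq)^\ell\right). \]
   Context: For a partition $\pi$ with largest part $L$, a missing integer of $\pi$ is a positive integer less than $L$ that does not occur as a part of $\pi$. ''Missing integers $\geq j$'' are the missing integers $i$ with $j\le i<L$. Notation: $(a;q)_0=1$, $(a;q)_n=(1-a)(1-aq)\cdots(1-aq^{n-1})$ and $(a;q)_\infty=\prod_{i\ge1}(1-aq^{i-1})$.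
   Formalization: P_j(n,m) counts only partitions with largest part L ≥ j (otherwise the identity fails for j ≥ 2: for j = 2 the partition 1 adds q on the left, while the right is O(q^2)); also assumed: |wq| < 1 for convergence, and w ≠ 0, ((w-1)/w;q)_j ≠ 0 so that the right side is defined. *)

(* Defs.v *)
From mathcomp Require Import all_boot all_order all_algebra.
From mathcomp Require Import boolp classical_sets reals topology normedtype sequences.
From mathcomp Require Import complex.

Set Implicit Arguments.
Unset Strict Implicit.
Unset Printing Implicit Defensive.

Import Order.TTheory GRing.Theory Num.Theory.
Import numFieldNormedType.Exports.

Local Open Scope classical_set_scope.
Local Open Scope ring_scope.
Local Open Scope complex_scope.

Section Partitions.
Local Open Scope nat_scope.

Definition is_partition (n : nat) (s : seq nat) : bool :=
  [&& sorted geq s, 0 \notin s & sumn s == n].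

Definition largest_part (s : seq nat) : nat := \max_(i <- s) i.

Definition missing_integers (s : seq nat) : seq nat :=
  [seq i <- iota 1 (largest_part s).-1 | i \notin s].

Definition num_missing_ge (j : nat) (s : seq nat) : nat :=
  count (fun i => j <= i) (missing_integers s).

(* A partition of n has at most n parts, each at most n, so it lies in the
   finite type n.-bseq 'I_n.+1 (see partition_bseq).
   The range j <= i < L of the missing integers >= j presupposes j <= L, so
   only partitions with largest part L >= j are counted.  If those with L < j
   were counted too (with m = 0), the left-hand side of the generating function
   identity would gain sum_(1 <= L < j) q^L / (q; q)_L, and the identity would
   fail for every j >= 2.  For j = 1 the condition holds for every n >= 1. *)
Definition P (j n m : nat) : nat :=
  #|[set t : n.-bseq 'I_n.+1 |
      let s := [seq nat_of_ord i | i <- t] in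
      [&& is_partition n s, j <= largest_part s & num_missing_ge j s == m]]|.

Lemma partition_bseq n s :
  is_partition n s ->
  exists t : n.-bseq 'I_n.+1, [seq nat_of_ord i | i <- t] = s.
Proof.
case/and3P=> _ s0 /eqP sn.
have le_size : size s <= n.
  rewrite -sn; elim: s s0 {sn} => //= x s IHs.
  rewrite inE negb_or => /andP[x0 /IHs le_s].
  by rewrite -add1n leq_add // lt0n eq_sym.
have le_mem i : i \in s -> i <= n.
  rewrite -sn; elim: s {s0 sn le_size} => //= x s IHs.
  rewrite inE => /orP[/eqP ->|/IHs le_i]; first exact: leq_addr.
  exact: leq_trans le_i (leq_addl _ _).
have size_t : size [seq inord i : 'I_n.+1 | i <- s] <= n by rewrite size_map.
exists (Bseq size_t); rewrite /= -map_comp -[RHS]map_id.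
by apply/eq_in_map => i /le_mem le_i; rewrite /= inordK.
Qed.

End Partitions.

Definition qpoch (R : realType) (a q : R[i]) (n : nat) : R[i] :=
  \prod_(0 <= k < n) (1 - a * q ^+ k).

(* R[i]^o carries the topology given by the modulus. *)
Definition qpoch_inf (R : realType) (a q : R[i]) : R[i] :=
  lim ((qpoch a q n : R[i]^o) @[n --> \oo]).

(* Main.v *)
(** Sorting the partitions by their largest part [L >= j], a part size [i < j]
    contributes the factor [1 / (1 - q ^ i)], a size [j <= i < L] contributes
    [w + q ^ i / (1 - q ^ i)] and [L] contributes [q ^ L / (1 - q ^ L)].  Since
    [w + q ^ i / (1 - q ^ i) = w (1 - a q ^ i) / (1 - q ^ i)] for
    [a = (w - 1) / w], the summand is
    [w ^ - j / (a; q)_j * (a; q)_L / (q; q)_L * (w q) ^ L], and the q-binomial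
    theorem sums the series.

    The rearrangement is justified by finite boxes: partitions with parts at
    most [K] and multiplicities at most [M].  Their generating function is a
    finite product, and its distance to the sum over the partitions of the
    integers below [N] is at most [sigma - b], where [b] is the same box sum
    with [|w|], [|q|] in place of [w], [q], and [sigma] is the limit of these
    box sums, finite because the theorem's closed form also applies to [|w|],
    [|q|]. *)
Require Import Defs.
From mathcomp Require Import all_boot all_order all_algebra.
From mathcomp Require Import boolp classical_sets reals topology normedtype sequences.
From mathcomp Require Import complex.
From mathcomp Require Import ring lra zify exp.
Import Order.TTheory GRing.Theory Num.Theory.
Import numFieldNormedType.Exports.
Import Normc.
Local Open Scope classical_set_scope.
Local Open Scope ring_scope.
Local Open Scope complex_scope.

(** * Partitions in a box *)

(** The multiplicity of the largest admissible part is chosen first, so every entry comes out weakly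
    decreasing and sums over the box factor one part size at a time. *)
Fixpoint box_partitions (K M : nat) : seq (seq nat) :=
  if K is K'.+1 then
    [seq nseq c K ++ s | c <- iota 0 M.+1, s <- box_partitions K' M]
  else [:: [::]].

Lemma sorted_nseq_cat (c K : nat) (s : seq nat) :
  all (leq^~ K) s -> sorted geq s -> sorted geq (nseq c K ++ s).
Proof.
move=> sK ss; elim: c => //= c IHc.
have geq_trans : transitive geq by move=> ? ? ? /[swap]; exact: leq_trans.
rewrite (path_sortedE geq_trans) IHc andbT all_cat sK andbT.
by apply/allP => x /nseqP[->] _; exact: leqnn.
Qed.

Lemma sorted_geq_split (K : nat) (s : seq nat) :
  sorted geq s -> all (leq^~ K.+1) s ->
  s = nseq (count_mem K.+1 s) K.+1 ++ [seq x <- s | x <= K]%N.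
Proof.
have geq_trans : transitive geq by move=> ? ? ? /[swap]; exact: leq_trans.
elim: s => //= x s IHs; rewrite (path_sortedE geq_trans) => /andP[xs ss].
case/andP=> xK sK; have [->|xK1] := eqVneq x K.+1.
  by rewrite ltnn add1n /= -IHs.
(* A head different from [K.+1] bounds the whole tail by [K], so no copy of [K.+1] remains. *)
have {}xK : (x <= K)%N by rewrite -ltnS ltn_neqAle xK1.
have sK' : all (leq^~ K) s.
  by apply: sub_all xs => y /leq_trans; apply.
rewrite xK (all_filterP sK') add0n.
have /eqP -> // : count_mem K.+1 s == 0%N.
rewrite -leqn0 leqNgt -has_count -all_predC; apply: sub_all sK' => y /= yK.
by rewrite neq_ltn ltnS yK.
Qed.

Lemma mem_box_partitions (K M : nat) (s : seq nat) :
  (s \in box_partitions K M) =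
  [&& sorted geq s, 0%N \notin s, all (leq^~ K) s &
      all (fun i => count_mem i s <= M)%N s].
Proof.
elim: K s => [|K IHK] s.
  rewrite inE; apply/eqP/and4P => [-> // | [_ s0 sK _]].
  case: s s0 sK => //= x s; rewrite inE negb_or => /andP[x0 _] /andP[].
  by rewrite leqn0 eq_sym (negbTE x0).
apply/allpairsP/and4P => [[[c t] /= [+ + ->]]|[ss s0 sK sM]].
  rewrite -[_ :: _]/(iota 0 M.+1) mem_iota add0n ltnS => /andP[_ cM].
  rewrite IHK => /and4P[ts t0 tK tM].
  have tK1 : all (leq^~ K.+1) t by apply: sub_all tK => x; exact: leqW.
  have K1t : K.+1 \notin t.
    by apply/negP => /(allP tK); rewrite ltnn.
  split.
  - exact: sorted_nseq_cat.
  - by rewrite mem_cat negb_or t0 andbT mem_nseq andbF.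
  - by rewrite all_cat tK1 andbT; apply/allP => x /nseqP[->].
  apply/allP => x; rewrite mem_cat count_cat count_nseq /=.
  case/orP => [/nseqP[-> _]|xt].
    by rewrite eqxx mul1n (count_memPn K1t) addn0.
  have /negbTE -> : K.+1 != x by apply: contraNneq K1t => ->.
  by rewrite mul0n; exact: (allP tM).
exists (count_mem K.+1 s, [seq x <- s | x <= K]%N) => /=; split.
- rewrite -[_ :: _]/(iota 0 M.+1) mem_iota add0n ltnS /=.
  have [/(allP sM) //|/count_memPn -> //] := boolP (K.+1 \in s).
- rewrite IHK; apply/and4P; split.
  + by apply: sorted_filter ss; move=> ? ? ? /[swap]; exact: leq_trans.
  + by rewrite mem_filter negb_and s0 orbT.
  + exact: filter_all.
  apply/allP => x; rewrite mem_filter => /andP[_ /(allP sM)].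
  by apply: leq_trans; rewrite count_filter; apply: sub_count => y /= /andP[].
- exact: sorted_geq_split.
Qed.

(** The tail contains no [K.+1], so [c] is recovered as the number of copies of [K.+1], and then the
    tail by cancellation. *)
Lemma box_partitions_uniq (K M : nat) : uniq (box_partitions K M).
Proof.
elim: K => // K IHK; apply: allpairs_uniq (iota_uniq 0 M.+1) IHK _.
have count_head c t : t \in box_partitions K M ->
    count_mem K.+1 (nseq c K.+1 ++ t) = c.
  rewrite mem_box_partitions count_cat count_nseq /= eqxx mul1n.
  case/and4P=> _ _ tK _; suff /count_memPn -> : K.+1 \notin t by rewrite addn0.
  by apply/negP => /(allP tK); rewrite ltnn.
move=> _ _ /allpairsP[[c s] [_ sP ->]] /allpairsP[[d t] [_ tP ->]] /= e.
have ecd : c = d by rewrite -(count_head c s) // -(count_head d t) // e.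
by move/eqP: e; rewrite ecd eqseq_cat // eqxx => /eqP ->.
Qed.

(* The missing integers [>= j] of a partition with parts at most [K] once a part
   [K.+1] is added to it; unlike [num_missing_ge] this is additive in [K]. *)
Definition num_gaps (j K : nat) (s : seq nat) : nat :=
  count (fun i => (j <= i)%N && (i \notin s)) (iota 1 K).

Lemma largest_part_box (K c : nat) (s : seq nat) :
  all (leq^~ K) s -> largest_part (nseq c.+1 K.+1 ++ s) = K.+1.
Proof.
move=> sK; apply/eqP; rewrite eqn_leq; apply/andP; split; last first.
  by apply: (@leq_bigmax_seq _ _ xpredT id) => //; rewrite inE eqxx.
apply/bigmax_leqP_seq => x; rewrite mem_cat => /orP[/nseqP[-> //]|xs _].
by apply: leqW; exact: (allP sK).
Qed.

Lemma num_missing_ge_box (j K c : nat) (s : seq nat) :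
  all (leq^~ K) s ->
  num_missing_ge j (nseq c.+1 K.+1 ++ s) = num_gaps j K s.
Proof.
move=> sK; rewrite /num_missing_ge /missing_integers largest_part_box //.
rewrite count_filter; apply: eq_in_count => i.
rewrite mem_iota add1n ltnS => /andP[_ iK] /=.
by rewrite inE mem_cat mem_nseq (ltn_eqF (iK : (i < K.+1)%N)) andbF.
Qed.

Lemma num_gaps_box (j K c : nat) (s : seq nat) :
  all (leq^~ K) s ->
  num_gaps j K.+1 (nseq c K.+1 ++ s) =
  (num_gaps j K s + ((j <= K.+1) && (c == 0)))%N.
Proof.
move=> sK; rewrite /num_gaps -[X in iota _ X]addn1 iotaD count_cat /= add1n.
have K1s : K.+1 \notin s by apply/negP => /(allP sK); rewrite ltnn.
rewrite addn0 mem_cat mem_nseq eqxx andbT (negbTE K1s) orbF -eqn0Ngt.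
congr addn; apply: eq_in_count => i; rewrite mem_iota add1n ltnS => /andP[_ iK].
by rewrite mem_cat mem_nseq (ltn_eqF (iK : (i < K.+1)%N)) andbF.
Qed.

(** The term outside the sum is the case of multiplicity [0]: a missing size weighs [w] from [j] on
    and [1] below. *)
Definition box_factor {F : comPzRingType} (j M : nat) (w q : F) (i : nat) : F :=
  (if (j <= i)%N then w else 1) + \sum_(1 <= c < M.+1) q ^+ i ^+ c.

Lemma sumn_nseq_cat (c K : nat) (s : seq nat) :
  sumn (nseq c K ++ s) = (K * c + sumn s)%N.
Proof. by rewrite sumn_cat sumn_nseq. Qed.

(** The summand of multiplicity [0] is kept apart: it is the only one in which [K.+1] does not
    become the largest part. *)
Lemma big_box_partitionsS (V : nmodType) (K M : nat) (P : pred (seq nat))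
    (F : seq nat -> V) :
  \sum_(s <- box_partitions K.+1 M | P s) F s =
  \sum_(s <- box_partitions K M | P s) F s +
  \sum_(1 <= c < M.+1) \sum_(s <- box_partitions K M | P (nseq c K.+1 ++ s))
     F (nseq c K.+1 ++ s).
Proof.
rewrite big_mkcond /= big_cat /= big_map -big_mkcond; congr (_ + _).
rewrite big_allpairs_dep /index_iota subSS subn0.
by apply: eq_bigr => c _; rewrite [RHS]big_mkcond.
Qed.

Lemma box_gaps_genfun (F : comPzRingType) (j K M : nat) (w q : F) :
  \sum_(s <- box_partitions K M) w ^+ num_gaps j K s * q ^+ sumn s =
  \prod_(1 <= i < K.+1) box_factor j M w q i.
Proof.
elim: K => [|K IHK]; first by rewrite big_seq1 big_nil expr0 mul1r.
rewrite big_nat_recr //= -IHK big_box_partitionsS mulrDr; congr (_ + _).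
  (* Multiplicity [0]: [s] is [nseq 0 K.+1 ++ s] by conversion, and the possible new gap at [K.+1]
     carries the weight. *)
  rewrite mulr_suml !big_seq; apply: eq_bigr => s.
  rewrite mem_box_partitions => /and4P[_ _ sK _].
  rewrite (num_gaps_box j K 0 s sK) andbT exprD; case: leqP => _; ring.
rewrite mulr_sumr !big_nat; apply: eq_bigr => c /andP[c0 _].
rewrite mulr_suml !big_seq; apply: eq_bigr => s.
rewrite mem_box_partitions => /and4P[_ _ sK _].
rewrite (num_gaps_box j K c s sK) (gtn_eqF c0) andbF addn0.
by rewrite sumn_nseq_cat exprD exprM; ring.
Qed.

(** Induction on [K]: the new entries are those with largest part [K.+1]; below that part the rest
    is an arbitrary entry of the smaller box, and the missing integers are the gaps of this rest. *)
Lemma box_genfun (F : comPzRingType) (j K M : nat) (w q : F) :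
  (0 < j)%N ->
  \sum_(s <- box_partitions K M | (j <= largest_part s)%N)
     w ^+ num_missing_ge j s * q ^+ sumn s =
  \sum_(1 <= L < K.+1 | (j <= L)%N)
     (\sum_(1 <= c < M.+1) q ^+ L ^+ c) *
     \prod_(1 <= i < L) box_factor j M w q i.
Proof.
move=> j0; elim: K => [|K IHK].
  (* The only entry is the empty partition, with largest part [0 < j]. *)
  by rewrite big_mkcond big_seq1 /largest_part big_nil leqNgt j0 big_nil.
rewrite [RHS]big_mkcond big_nat_recr //= -big_mkcond -IHK big_box_partitionsS; congr (_ + _).
have [jK|jK] := leqP; last first.
  rewrite big_nat big1 // => -[//|c] _; rewrite big_seq_cond big1 // => s /andP[].
  rewrite mem_box_partitions => /and4P[_ _ sK _].
  by rewrite largest_part_box // leqNgt jK.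
rewrite -box_gaps_genfun mulr_suml !big_nat; apply: eq_bigr => -[//|c] _.
rewrite mulr_sumr big_seq_cond [RHS]big_seq_cond; apply: eq_big => s.
  case: (boolP (s \in _)) => //=.
  by rewrite mem_box_partitions => /and4P[_ _ sK _]; rewrite largest_part_box ?jK.
case/andP; rewrite mem_box_partitions => /and4P[_ _ sK _] _.
by rewrite num_missing_ge_box // sumn_nseq_cat exprD exprM; ring.
Qed.

(** * Boxes and the partitions of the integers below a bound *)

Lemma box_partitions_sub (K K' M M' : nat) :
  (K <= K')%N -> (M <= M')%N ->
  {subset box_partitions K M <= box_partitions K' M'}.
Proof.
move=> KK' MM' s; rewrite !mem_box_partitions => /and4P[-> -> sK sM] /=.
apply/andP; split; first by apply: sub_all sK => x /leq_trans; apply.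
by apply: sub_all sM => x /leq_trans; apply.
Qed.

Lemma box_partitions_is_partition (K M : nat) (s : seq nat) :
  s \in box_partitions K M -> is_partition (sumn s) s.
Proof.
by rewrite mem_box_partitions /is_partition eqxx => /and4P[-> ->].
Qed.

(** With no zero part, both the parts and their number are at most the sum, hence so are the
    multiplicities. *)
Lemma is_partition_box (n N : nat) (s : seq nat) :
  is_partition n s -> (n <= N)%N -> s \in box_partitions N N.
Proof.
case/and3P=> ss s0 /eqP sn nN; rewrite mem_box_partitions ss s0 /=.
have bound : forall t : seq nat, 0%N \notin t ->
    all (leq^~ (sumn t)) t && (size t <= sumn t)%N.
  elim=> //= x t IHt; rewrite inE negb_or eq_sym => /andP[x0 /IHt /andP[tall tsz]].
  rewrite leq_addr /= -add1n leq_add ?lt0n // andbT.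
  by apply: sub_all tall => y /leq_trans; apply; exact: leq_addl.
have /andP[ball bsz] := bound s s0.
apply/andP; split.
  by apply: sub_all ball => y /leq_trans; apply; rewrite sn.
apply/allP => x _; apply: leq_trans (count_size _ _) _.
by apply: leq_trans bsz _; rewrite sn.
Qed.

(** Enumerated through the finite type used by [P], so that counts and sums can be matched term by
    term. *)
Definition partitions (n : nat) : seq (seq nat) :=
  [seq [seq nat_of_ord i | i <- val t] |
     t <- enum {: n.-bseq 'I_n.+1} & is_partition n [seq nat_of_ord i | i <- val t]].

Lemma mem_partitions (n : nat) (s : seq nat) :
  (s \in partitions n) = is_partition n s.
Proof.
apply/mapP/idP => [[t + ->]|sP]; first by rewrite mem_filter => /andP[].
have [t ts] := partition_bseq sP.
by exists t => //; rewrite mem_filter mem_enum andbT ts.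
Qed.

Lemma partitions_uniq (n : nat) : uniq (partitions n).
Proof.
rewrite map_inj_uniq; first exact: filter_uniq (enum_uniq _).
move=> t u /= tu.
by apply: val_inj; apply: inj_map tu; exact: val_inj.
Qed.

(** After exchanging the sums, each partition contributes at a single [m], and that [m] is at most
    [n], so the cutoff [M > n] loses nothing. *)
Lemma sum_P_partitions (F : comPzRingType) (j n M : nat) (w q : F) :
  (n < M)%N ->
  \sum_(0 <= m < M) (P j n m)%:R * w ^+ m * q ^+ n =
  \sum_(s <- partitions n | (j <= largest_part s)%N)
     w ^+ num_missing_ge j s * q ^+ sumn s.
Proof.
move=> nM; pose v (t : n.-bseq 'I_n.+1) := [seq nat_of_ord i | i <- val t].
pose Q t := is_partition n (v t) && (j <= largest_part (v t))%N.
transitivity (\sum_(0 <= m < M) \sum_(t | Q t)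
    if m == num_missing_ge j (v t) then w ^+ num_missing_ge j (v t) * q ^+ n else 0).
  apply: eq_bigr => m _; rewrite -big_mkcondr /= -mulrA mulr_natl /P -sumr_const.

  apply: eq_big => [t|t]; rewrite [_ \in _]asboolb /= /Q.
    by rewrite -(andbA (is_partition _ _)) [m == _]eq_sym.
  by case/and3P=> _ _ /eqP ->.
rewrite exchange_big /= [RHS]big_map big_filter_cond big_enum_cond /=.
apply: eq_bigr => t /andP[/and3P[_ _ /eqP sn] _]; rewrite -big_mkcond /=.
rewrite big_nat1_eq sn ifT //= (leq_ltn_trans _ nM) //.
(* The count is at most [L.-1] for the largest part [L], and parts are at most [n] because they come
   from ['I_n.+1]. *)
apply: leq_trans (count_size _ _) _; rewrite size_filter.
apply: leq_trans (count_size _ _) _; rewrite size_iota.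
apply: leq_trans (leq_pred _) _; apply/bigmax_leqP_seq => i.
by case/mapP=> k _ -> _; rewrite -ltnS.
Qed.

Definition partitions_lt (N : nat) : seq (seq nat) :=
  flatten [seq partitions n | n <- index_iota 1 N].

Lemma mem_partitions_lt (N : nat) (s : seq nat) :
  (s \in partitions_lt N) = is_partition (sumn s) s && (0 < sumn s < N)%N.
Proof.
apply/flatten_mapP/idP => [[n]|/andP[sP sN]].
  rewrite mem_index_iota mem_partitions => nN sP.
  by have /and3P[_ _ /eqP ->] := sP; rewrite sP.
by exists (sumn s); rewrite ?mem_index_iota ?mem_partitions.
Qed.

Lemma partitions_lt_uniq (N : nat) : uniq (partitions_lt N).
Proof.
elim: N => [|[|N] IHN] //; rewrite /partitions_lt.
have -> : index_iota 1 N.+2 = index_iota 1 N.+1 ++ [:: N.+1].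
  by rewrite /index_iota !subSS !subn0 -[X in iota _ X = _]addn1 iotaD.
rewrite map_cat flatten_cat cat_uniq -/(partitions_lt N.+1) IHN /= cats0.
rewrite partitions_uniq andbT; apply/hasPn => s; rewrite mem_partitions => sP.
have /and3P[_ _ /eqP sn] := sP.
by rewrite -[_ \notin _]/(s \notin partitions_lt N.+1) mem_partitions_lt sn ltnn !andbF.
Qed.

Lemma sum_P_partitions_lt (F : comPzRingType) (j N : nat) (w q : F) :
  \sum_(1 <= n < N) \sum_(0 <= m < n.+1) (P j n m)%:R * w ^+ m * q ^+ n =
  \sum_(s <- partitions_lt N | (j <= largest_part s)%N)
     w ^+ num_missing_ge j s * q ^+ sumn s.
Proof.
rewrite big_flatten big_map; apply: eq_bigr => n _.
exact: sum_P_partitions.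
Qed.

Lemma partitions_lt_sub_box (N K M : nat) :
  (N <= K)%N -> (N <= M)%N ->
  {subset partitions_lt N <= box_partitions K M}.
Proof.
move=> NK NM s; rewrite mem_partitions_lt => /and3P[sP _ sN].
by apply: (box_partitions_sub _ _ _ _ NK NM); apply: is_partition_box sP (ltnW sN).
Qed.

(** The sums of the finitely many entries are bounded; [0 < j] keeps out the empty partition, whose
    sum [0] is below the range of [partitions_lt]. *)
Lemma box_sub_partitions_lt (j K M : nat) :
  (0 < j)%N ->
  exists N0 : nat, forall N : nat, (N0 <= N)%N ->
  forall s : seq nat, s \in box_partitions K M -> (j <= largest_part s)%N ->
    s \in partitions_lt N.
Proof.
move=> j0; exists (\max_(s <- box_partitions K M) sumn s).+1 => N NN s sB js.
rewrite mem_partitions_lt (box_partitions_is_partition _ _ _ sB) /=.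
rewrite (leq_trans _ NN) ?ltnS ?leq_bigmax_seq // andbT lt0n.
apply: contraTneq js => s0; rewrite -ltnNge; apply: leq_trans _ j0.
rewrite ltnS; apply/bigmax_leqP_seq => i si _; rewrite -s0.
by elim: (s) si => //= x t IHt; rewrite inE => /orP[/eqP ->|/IHt /leq_trans->//]; lia.
Qed.

(** * Convergence of complex sequences *)

(** The norm of [R[i]] has its values in [R[i]]; the real-valued [normc] brings the estimates into
    the ordered field [R]. *)
Lemma normCE (R : realType) (z : R[i]) : `|z| = (normc z)%:C.
Proof. by case: z. Qed.

Lemma norm_lt1 (R : realType) (z : R[i]) : (`|z| < 1) = (normc z < 1).
Proof. by rewrite normCE -[1]/(1%:C) ltcR. Qed.

Lemma normc_ge0 (R : realType) (z : R[i]) : 0 <= normc z.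
Proof. by case: z => a b; exact: sqrtr_ge0. Qed.

Lemma normcD (R : realType) (x y : R[i]) : normc (x + y) <= normc x + normc y.
Proof. exact: le_normcD. Qed.

Lemma normcB (R : realType) (x y : R[i]) : normc (x - y) <= normc x + normc y.
Proof. by rewrite -(normcN y) normcD. Qed.

Lemma normcX (R : realType) (x : R[i]) (n : nat) : normc (x ^+ n) = normc x ^+ n.
Proof. by elim: n => [|n IHn]; rewrite ?normc1 // !exprS normcM IHn. Qed.

Lemma normc_real (R : realType) (x : R) : 0 <= x -> normc x%:C = x.
Proof. by move=> x0; rewrite /= expr0n addr0 sqrtr_sqr ger0_norm. Qed.

Lemma normc_sum (R : realType) (I : Type) (r : seq I) (Q : pred I) (F : I -> R[i]) :
  normc (\sum_(i <- r | Q i) F i) <= \sum_(i <- r | Q i) normc (F i).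
Proof.
elim/big_ind2: _ => [|x a y b xa yb|//]; first by rewrite normc0.
by apply: le_trans (normcD _ _ _) _; exact: lerD.
Qed.

Lemma normc_prod (R : realType) (I : Type) (r : seq I) (Q : pred I) (F : I -> R[i]) :
  normc (\prod_(i <- r | Q i) F i) = \prod_(i <- r | Q i) normc (F i).
Proof. by apply: (big_morph _ (@normcM R)); exact: normc1. Qed.

Lemma ler_normc_Re (R : realType) (z : R[i]) : `|complex.Re z| <= normc z.
Proof. by rewrite -lecR -normCE normc_ge_Re. Qed.

Lemma ler_normc_Im (R : realType) (z : R[i]) : `|complex.Im z| <= normc z.
Proof.
case: z => a b /=; rewrite -sqrtr_sqr ler_sqrt ?lerDr ?sqr_ge0 //.
by rewrite addr_ge0 ?sqr_ge0.
Qed.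

Lemma normc_le_ReIm (R : realType) (z : R[i]) : normc z <= `|complex.Re z| + `|complex.Im z|.
Proof.
case: z => a b /=; rewrite -[leRHS]ger0_norm ?addr_ge0 // -sqrtr_sqr.
by rewrite ler_sqrt ?sqr_ge0 // sqrrD !real_normK ?num_real // lerD2r lerDl mulrn_wge0 ?mulr_ge0.
Qed.

Lemma cvg_normcP (R : realType) (u : nat -> R[i]^o) (l : R[i]^o) :
  u n @[n --> \oo] --> l <-> normc (l - u n) @[n --> \oo] --> (0 : R).
Proof.
split=> [/cvgrPdist_lt H|/cvgrPdist_lt H]; apply/cvgrPdist_lt => e e0.
  near=> n; rewrite sub0r normrN ger0_norm ?normc_ge0 // -ltcR -normCE.
  by near: n; apply: H; rewrite ltcR.
(* A positive element of [R[i]] is real, so [e] also serves as a real bound. *)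
have eR : (complex.Re e)%:C = e by apply: RRe_real; exact: gtr0_real.
have {}e0 : 0 < complex.Re e by rewrite -ltcR eR.
near=> n; rewrite normCE -eR ltcR.
have : `|0 - normc (l - u n)| < complex.Re e by near: n; exact: H.
by rewrite sub0r normrN ger0_norm ?normc_ge0.
Unshelve. all: by end_near. Qed.

Lemma cvg_normc (R : realType) (u : nat -> R[i]^o) (l : R[i]^o) :
  u n @[n --> \oo] --> l -> normc (u n) @[n --> \oo] --> normc l.
Proof.
move=> /cvg_normcP/cvgrPdist_lt H; apply/cvgrPdist_lt => e e0; near=> n.
have : `|0 - normc (l - u n)| < e by near: n; exact: H.
rewrite sub0r normrN ger0_norm ?normc_ge0 //; apply: le_lt_trans.
have h1 : normc l <= normc (l - u n) + normc (u n).
  by apply: le_trans (normcD _ _ _); rewrite subrK.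
have h2 : normc (u n) <= normc (l - u n) + normc l.
  rewrite -(normcN (l - u n)) opprB.
  by apply: le_trans (normcD _ _ _); rewrite subrK.
by rewrite ler_norml; lra.
Unshelve. all: by end_near. Qed.

(** The telescoping series converges absolutely by comparison with a geometric one. *)
Lemma cvgn_geometric_increments (R : realType) (u : nat -> R) (C x : R) :
  0 <= x -> x < 1 -> (forall n, `|u n.+1 - u n| <= C * x ^+ n) ->
  cvg (u n @[n --> \oo]).
Proof.
move=> x0 x1 hu; have C0 : 0 <= C.
  by have := le_trans (normr_ge0 _) (hu 0%N); rewrite expr0 mulr1.
have hcv : cvgn (series (telescope u)).
  apply: normed_cvg; apply: (@series_le_cvg _ _ (geometric C x)) => n //=.
  - by rewrite mulr_ge0 ?exprn_ge0.
  - exact: hu.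
  - by apply: is_cvg_geometric_series; rewrite ger0_norm.
apply: (cvgP (u 0%N + limn (series (telescope u)))).
rewrite [X in X @ _ --> _](_ : _ = (fun=> u 0%N) \+ series (telescope u)).
  by apply: cvgD; [exact: cvg_cst | exact: hcv].
by apply/funext => n; exact: eq_sum_telescope.
Qed.

(* The library does not declare [R[i]] complete; completeness is read off the
   real and imaginary parts. *)
Lemma cvgc_geometric_increments (R : realType) (u : nat -> R[i]^o) (C x : R) :
  0 <= x -> x < 1 -> (forall n, normc (u n.+1 - u n) <= C * x ^+ n) ->
  cvg (u n @[n --> \oo]).
Proof.
move=> x0 x1 hu.
have hRe : cvg (complex.Re (u n) @[n --> \oo]).
  apply: (@cvgn_geometric_increments _ _ C x) => // n.
  by apply: le_trans (hu n); rewrite -raddfB; exact: ler_normc_Re.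
have hIm : cvg (complex.Im (u n) @[n --> \oo]).
  apply: (@cvgn_geometric_increments _ _ C x) => // n.
  by apply: le_trans (hu n); rewrite -raddfB; exact: ler_normc_Im.
apply/cvg_ex; exists (lim (complex.Re (u n) @[n --> \oo]) +i* lim (complex.Im (u n) @[n --> \oo])).
apply/cvg_normcP.
apply: (@squeeze_cvgr _ _ _ _ (fun=> 0)
  (fun n => `|lim (complex.Re (u n) @[n --> \oo]) - complex.Re (u n)| +
            `|lim (complex.Im (u n) @[n --> \oo]) - complex.Im (u n)|)).
- near=> n; rewrite normc_ge0 /=; apply: le_trans (normc_le_ReIm _ _) _.
  by case: (u n).
- exact: cvg_cst.
rewrite -[0 in X in _ --> X]addr0; apply: cvgD.
  rewrite -(normr0 R) -(subrr (lim (complex.Re (u n) @[n --> \oo]))).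
  by apply: cvg_norm; apply: cvgB; [exact: cvg_cst | exact: hRe].
rewrite -(normr0 R) -(subrr (lim (complex.Im (u n) @[n --> \oo]))).
by apply: cvg_norm; apply: cvgB; [exact: cvg_cst | exact: hIm].
Unshelve. all: by end_near. Qed.

(** * The q-binomial theorem *)

Lemma sum_geometric_le (R : realType) (b x : R) (n : nat) :
  0 <= b -> 0 <= x -> x < 1 ->
  \sum_(0 <= k < n) b * x ^+ k <= b / (1 - x).
Proof.
move=> b0 x0 x1; have := @geometric_seriesE R b x (negbT (lt_eqF x1)).
move/(congr1 (fun f => f n)); rewrite seriesEnat /= => ->.
rewrite ler_pM2r ?invr_gt0 ?subr_gt0 // ler_piMr // gerBl exprn_ge0 //.
Qed.

(** From [1 + y <= expR y]. The bound is independent of [n], which makes the later bounds on [qpoch]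
    and its inverse uniform. *)
Lemma prod_1Dgeometric_le (R : realType) (b x : R) (n : nat) :
  0 <= b -> 0 <= x -> x < 1 ->
  \prod_(0 <= k < n) (1 + b * x ^+ k) <= expR (b / (1 - x)).
Proof.
move=> b0 x0 x1; apply: le_trans (_ : expR (\sum_(0 <= k < n) b * x ^+ k) <= _).
  rewrite expR_sum; apply: ler_prod => k _.
  by rewrite expR_ge1Dx andbT addr_ge0 ?mulr_ge0 ?exprn_ge0.
by rewrite ler_expR; exact: sum_geometric_le.
Qed.

Lemma qpochS (R : realType) (a q : R[i]) (n : nat) :
  qpoch a q n.+1 = qpoch a q n * (1 - a * q ^+ n).
Proof. by rewrite /qpoch big_nat_recr. Qed.

Lemma normc_qpoch_le (R : realType) (a q : R[i]) (n : nat) :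
  normc q < 1 -> normc (qpoch a q n) <= expR (normc a / (1 - normc q)).
Proof.
move=> q1; apply: le_trans (prod_1Dgeometric_le _ _ _ n (normc_ge0 _ a) (normc_ge0 _ q) q1).
rewrite normc_prod; apply: ler_prod => k _; rewrite normc_ge0 /=.
by apply: le_trans (normcB _ _ _) _; rewrite normc1 normcM normcX.
Qed.

Lemma subr1_normc_ge (R : realType) (z : R[i]) : 1 - normc z <= normc (1 - z).
Proof.
rewrite lerBlDr -(normc1 R); apply: le_trans (normcD _ _ _).
by rewrite subrK.
Qed.

Lemma subr1_neq0 (R : realType) (z : R[i]) : normc z < 1 -> 1 - z != 0.
Proof.
move=> z1; apply: contraTneq (subr1_normc_ge _ z) => ->.
by rewrite normc0 -ltNge subr_gt0.
Qed.

Lemma normcMX_lt1 (R : realType) (z q : R[i]) (k : nat) :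
  normc z < 1 -> normc q < 1 -> normc (z * q ^+ k) < 1.
Proof.
move=> z1 q1; apply: le_lt_trans z1.
by rewrite normcM normcX ler_piMr ?normc_ge0 // exprn_ile1 ?normc_ge0 // ltW.
Qed.

Lemma qpoch_neq0 (R : realType) (z q : R[i]) (n : nat) :
  normc z < 1 -> normc q < 1 -> qpoch z q n != 0.
Proof.
by move=> z1 q1; rewrite prodf_seq_neq0; apply/allP => k _; rewrite subr1_neq0 ?normcMX_lt1.
Qed.

(** With [t = |z| |q|^k <= |z|], each inverse factor has modulus at most [1 / (1 - t) = 1 + t / (1 -
    t) <= 1 + t / (1 - |z|)], and [prod_1Dgeometric_le] applies. *)
Lemma normc_qpochV_le (R : realType) (z q : R[i]) (n : nat) :
  normc z < 1 -> normc q < 1 ->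
  normc (qpoch z q n)^-1 <= expR (normc z / (1 - normc z) / (1 - normc q)).
Proof.
move=> z1 q1; have s0 : 0 < 1 - normc z by rewrite subr_gt0.
have b0 : 0 <= normc z / (1 - normc z) by rewrite divr_ge0 ?normc_ge0 // ltW.
apply: le_trans (prod_1Dgeometric_le _ _ _ n b0 (normc_ge0 _ q) q1).
rewrite -prodfV normc_prod; apply: ler_prod => k _; rewrite normc_ge0 /= normcV.
have tz : normc z * normc q ^+ k <= normc z.
  by rewrite ler_piMr ?normc_ge0 // exprn_ile1 ?normc_ge0 // ltW.
have t0 : 0 <= normc z * normc q ^+ k by rewrite mulr_ge0 ?exprn_ge0 ?normc_ge0.
have d0 : 0 < 1 - normc z * normc q ^+ k by lra.
apply: le_trans (_ : (1 - normc z * normc q ^+ k)^-1 <= _).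
  rewrite lef_pV2 ?posrE //.
    by apply: le_trans (subr1_normc_ge _ _); rewrite normcM normcX.
  by apply: lt_le_trans d0 _; apply: le_trans (subr1_normc_ge _ _); rewrite normcM normcX.
rewrite -[leLHS]mul1r ler_pdivrMr // mulrAC.
set t := normc z * _ in tz t0 d0 *; set s := 1 - normc z in s0 *.
have : 0 <= t * (normc z - t) / s.
  by apply: divr_ge0 (ltW s0); apply: mulr_ge0 => //; rewrite subr_ge0.
suff -> : (1 + t / s) * (1 - t) = 1 + t * (normc z - t) / s by lra.
by rewrite /s; field; rewrite gt_eqF.
Qed.

(** The increment is [- (qpoch a q n * (a * q ^+ n))], geometrically small because the partial
    products are bounded. *)
Lemma is_cvg_qpoch (R : realType) (a q : R[i]) :
  normc q < 1 -> cvg ((qpoch a q n : R[i]^o) @[n --> \oo]).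
Proof.
move=> q1; apply: (@cvgc_geometric_increments _ _
  (expR (normc a / (1 - normc q)) * normc a) (normc q)) => [|//|n].
  exact: normc_ge0.
rewrite qpochS.
have -> : qpoch a q n * (1 - a * q ^+ n) - qpoch a q n = - (qpoch a q n * (a * q ^+ n)) by ring.
rewrite normcN !normcM normcX -mulrA ler_wpM2r ?normc_qpoch_le //.
by rewrite mulr_ge0 ?exprn_ge0 ?normc_ge0.
Qed.

Lemma cvg_qpoch (R : realType) (a q : R[i]) :
  normc q < 1 -> (qpoch a q n : R[i]^o) @[n --> \oo] --> (qpoch_inf a q : R[i]^o).
Proof. exact: is_cvg_qpoch. Qed.

(** The uniform bound on the inverses keeps the partial products at modulus at least [e^-1], and the
    limit inherits this. *)
Lemma qpoch_inf_neq0 (R : realType) (z q : R[i]) :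
  normc z < 1 -> normc q < 1 -> qpoch_inf z q != 0.
Proof.
move=> z1 q1; set e := expR (normc z / (1 - normc z) / (1 - normc q)).
have e0 : 0 < e by exact: expR_gt0.
have : e^-1 <= normc (qpoch_inf z q).
  have h := cvg_normc _ _ _ (cvg_qpoch _ z q q1).
  rewrite -(cvg_lim (@Rhausdorff R) h); apply: limr_ge; first exact: cvgP h.
  near=> n; rewrite -[leRHS]invrK lef_pV2 ?posrE ?invr_gt0 //.
    by rewrite -normcV; exact: normc_qpochV_le.
  rewrite lt_neqAle normc_ge0 andbT eq_sym.
  by apply/eqP => /eq0_normc /eqP; apply/negP; exact: qpoch_neq0.
apply: contraTneq => ->; rewrite normc0 -ltNge invr_gt0 //.
Unshelve. all: by end_near. Qed.

(** Coefficients of the basic hypergeometric series 1phi0 with parameter [a] and base [q]. *)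
Definition qbin_coef {R : realType} (a q : R[i]) (l : nat) : R[i] :=
  qpoch a q l / qpoch q q l.

Definition qbin_sum {R : realType} (a q z : R[i]) (N : nat) : R[i]^o :=
  \sum_(0 <= l < N) qbin_coef a q l * z ^+ l.

Lemma qbin_coef_bound (R : realType) (a q : R[i]) :
  normc q < 1 -> exists C : R, forall l, normc (qbin_coef a q l) <= C.
Proof.
move=> q1; exists (expR (normc a / (1 - normc q)) *
  expR (normc q / (1 - normc q) / (1 - normc q))) => l.
by rewrite normcM ler_pM ?normc_ge0 ?normc_qpoch_le ?normc_qpochV_le.
Qed.

Lemma qbin_coef0 (R : realType) (a q : R[i]) : qbin_coef a q 0 = 1.
Proof. by rewrite /qbin_coef /qpoch !big_geq // divr1. Qed.

Lemma qbin_coefS (R : realType) (a q : R[i]) (l : nat) :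
  normc q < 1 ->
  qbin_coef a q l.+1 * (1 - q ^+ l.+1) = qbin_coef a q l * (1 - a * q ^+ l).
Proof.
move=> q1; rewrite /qbin_coef !qpochS exprS; field.
by rewrite qpoch_neq0 ?subr1_neq0 ?normcMX_lt1.
Qed.

Lemma qbin_sumS (R : realType) (a q z : R[i]) (N : nat) :
  qbin_sum a q z N.+1 = qbin_sum a q z N + qbin_coef a q N * z ^+ N.
Proof. by rewrite /qbin_sum big_nat_recr. Qed.

Lemma is_cvg_qbin_sum (R : realType) (a q z : R[i]) :
  normc q < 1 -> normc z < 1 -> cvg (qbin_sum a q z N @[N --> \oo]).
Proof.
move=> q1 z1; have [C hC] := qbin_coef_bound R a q q1.
apply: (@cvgc_geometric_increments _ _ C (normc z)) => // [|n]; first exact: normc_ge0.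
by rewrite qbin_sumS addrAC subrr add0r normcM normcX ler_wpM2r ?exprn_ge0 ?normc_ge0.
Qed.

Lemma cvgn_exprc (R : realType) (z : R[i]) :
  normc z < 1 -> (z ^+ n : R[i]^o) @[n --> \oo] --> (0 : R[i]^o).
Proof.
move=> z1; apply/cvg_normcP.
under eq_fun do rewrite sub0r normcN normcX.
by apply: cvg_expr; rewrite ger0_norm ?normc_ge0.
Qed.

Lemma cvg_squeeze0 (R : realType) (u : nat -> R[i]^o) (l : R[i]^o) (v : nat -> R) :
  (forall n, normc (l - u n) <= v n) -> v n @[n --> \oo] --> (0 : R) ->
  u n @[n --> \oo] --> l.
Proof.
move=> huv v0; apply/cvg_normcP.
apply: (@squeeze_cvgr _ _ _ _ (fun=> 0) v) => //; last exact: cvg_cst.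
by apply: nearW => n; rewrite normc_ge0 huv.
Qed.

Lemma cvg_geometric_normc (R : realType) (C : R) (z : R[i]) :
  normc z < 1 -> C * normc z ^+ n @[n --> \oo] --> (0 : R).
Proof.
move=> z1; rewrite -(mulr0 C); apply: cvgMl_tmp.
by apply: cvg_expr; rewrite ger0_norm ?normc_ge0.
Qed.

(* Partial-sum form of [(1 - z) F(z) = (1 - a z) F(q z)]; the right-hand side is
   the truncation error. *)
Lemma qbin_sum_qdiff (R : realType) (a q z : R[i]) (N : nat) :
  normc q < 1 ->
  (1 - z) * qbin_sum a q z N - (1 - a * z) * qbin_sum a q (z * q) N =
  - (qbin_coef a q N * (1 - q ^+ N) * z ^+ N).
Proof.
move=> q1; elim: N => [|N IHN].
  by rewrite /qbin_sum !big_nil expr0 subrr !mulr0 mul0r subr0 oppr0.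
rewrite qbin_coefS // !qbin_sumS.
have -> : (1 - z) * (qbin_sum a q z N + qbin_coef a q N * z ^+ N) -
    (1 - a * z) * (qbin_sum a q (z * q) N + qbin_coef a q N * (z * q) ^+ N) =
    ((1 - z) * qbin_sum a q z N - (1 - a * z) * qbin_sum a q (z * q) N) +
    qbin_coef a q N * ((1 - z) * z ^+ N - (1 - a * z) * (z * q) ^+ N) by ring.
by rewrite IHN exprMn exprS; ring.
Qed.

Definition qbin_series {R : realType} (a q z : R[i]) : R[i]^o :=
  lim (qbin_sum a q z N @[N --> \oo]).

Lemma cvg_qbin_sum (R : realType) (a q z : R[i]) :
  normc q < 1 -> normc z < 1 ->
  qbin_sum a q z N @[N --> \oo] --> qbin_series a q z.
Proof. exact: is_cvg_qbin_sum. Qed.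

Lemma cvgn_unique (R : realType) (u : nat -> R[i]^o) (l l' : R[i]^o) :
  u n @[n --> \oo] --> l -> u n @[n --> \oo] --> l' -> l = l'.
Proof. exact: cvg_unique. Qed.

Lemma qbin_series_qdiff (R : realType) (a q z : R[i]) :
  normc q < 1 -> normc z < 1 ->
  (1 - z) * qbin_series a q z = (1 - a * z) * qbin_series a q (z * q).
Proof.
move=> q1 z1; have zq1 : normc (z * q) < 1 by rewrite -(expr1 q) normcMX_lt1.
have [C hC] := qbin_coef_bound R a q q1.
apply/eqP; rewrite -subr_eq0; apply/eqP.
apply: (@cvgn_unique _ (fun N => (1 - z) * qbin_sum a q z N -
    (1 - a * z) * qbin_sum a q (z * q) N)).
  by apply: cvgB; apply: cvgMl_tmp; exact: cvg_qbin_sum.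
(* The factor [2] bounds [1 - q ^+ N] in modulus. *)
apply: (@cvg_squeeze0 _ _ _ (fun N => C * 2 * normc z ^+ N)); last exact: cvg_geometric_normc.
move=> N; rewrite qbin_sum_qdiff // sub0r opprK 2!normcM normcX.
rewrite ler_wpM2r ?exprn_ge0 ?normc_ge0 // ler_pM ?normc_ge0 //.
apply: le_trans (normcB _ _ _) _; rewrite normc1 normcX.
have : normc q ^+ N <= 1 by rewrite exprn_ile1 ?normc_ge0 // ltW.
by lra.
Qed.

(** Iterating the functional equation pushes the argument towards [0], where the series tends to
    [1]. *)
Lemma qbin_series_iter (R : realType) (a q z : R[i]) (n : nat) :
  normc q < 1 -> normc z < 1 ->
  qpoch z q n * qbin_series a q z =
  qpoch (a * z) q n * qbin_series a q (z * q ^+ n).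
Proof.
move=> q1 z1; elim: n => [|n IHn].
  by rewrite expr0 mulr1 /qpoch !(big_geq (leqnn 0)).
rewrite !qpochS.
rewrite mulrAC IHn mulrAC -mulrA [_ * (1 - _)]mulrC.
rewrite (qbin_series_qdiff _ a _ _ q1 (normcMX_lt1 _ _ _ n z1 q1)).
by rewrite -(mulrA z) -exprSr -(mulrA a); ring.
Qed.

(** Continuity at [0] with a rate: the tail from [l = 1] is dominated by [C] times a geometric
    series, and [C] does not depend on [z]. *)
Lemma qbin_series_near0 (R : realType) (a q : R[i]) :
  normc q < 1 -> exists C : R, forall z : R[i], normc z < 1 ->
  normc (1 - qbin_series a q z) <= C * (normc z / (1 - normc z)).
Proof.
move=> q1; have [C hC] := qbin_coef_bound R a q q1; exists C => z z1.
have C0 : 0 <= C by apply: le_trans (normc_ge0 _ _) (hC 0%N).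
have h : normc (1 - qbin_sum a q z N) @[N --> \oo] --> normc (1 - qbin_series a q z).
  by apply: cvg_normc; apply: cvgB; [exact: cvg_cst | exact: cvg_qbin_sum].
rewrite -(cvg_lim (@Rhausdorff R) h); apply: limr_le; first exact: cvgP h.
near=> N; have : (0 < N)%N by near: N; exact: nbhs_infty_gt.
case: (N) => // n _; rewrite /qbin_sum big_nat_recl //= qbin_coef0.
rewrite mulr1 opprD addrA subrr sub0r normcN.
apply: le_trans (normc_sum _ _ _ _ _) _; rewrite mulrA.
apply: le_trans (sum_geometric_le _ _ _ n _ _ z1); last first.
- exact: normc_ge0.
- by rewrite mulr_ge0 ?normc_ge0.
apply: ler_sum => l _; rewrite normcM normcX exprS mulrA.
by rewrite ler_wpM2r ?exprn_ge0 ?normc_ge0 // ler_wpM2r ?normc_ge0 //; exact: hC.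
Unshelve. all: by end_near. Qed.

(** Let [n] tend to infinity in [qbin_series_iter]: both Pochhammer symbols become infinite
    products, and the series at [z * q ^+ n] tends to [1]. *)
Lemma q_binomial (R : realType) (a q z : R[i]) :
  normc q < 1 -> normc z < 1 ->
  qbin_series a q z = qpoch_inf (a * z) q / qpoch_inf z q.
Proof.
move=> q1 z1; apply: (canRL (mulfK (qpoch_inf_neq0 _ z q z1 q1))).
rewrite mulrC -[RHS]mulr1.
apply: (@cvgn_unique _ (fun n => qpoch z q n * qbin_series a q z)).
  by apply: cvgMr_tmp; exact: cvg_qpoch.
under eq_fun do rewrite qbin_series_iter //.
apply: cvgM; first exact: cvg_qpoch.
have [C hC] := qbin_series_near0 R a q q1.
(* Taking [|C|] avoids the sign of [C], and [1 - |z q^n|] is bounded below by [1 - |z|]. *)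
apply: (@cvg_squeeze0 _ _ _ (fun n => `|C| * (normc z / (1 - normc z)) * normc q ^+ n));
  last exact: cvg_geometric_normc.
move=> n; apply: le_trans (hC _ (normcMX_lt1 _ _ _ n z1 q1)) _.
have s0 : 0 < 1 - normc z by rewrite subr_gt0.
have d0 : 0 < 1 - normc (z * q ^+ n) by rewrite subr_gt0 normcMX_lt1.
have hz : 1 - normc z <= 1 - normc (z * q ^+ n).
  rewrite lerD2l lerN2 normcM normcX ler_piMr ?normc_ge0 //.
  by rewrite exprn_ile1 ?normc_ge0 // ltW.
apply: le_trans (ler_wpM2r _ (ler_norm C)) _.
  by rewrite divr_ge0 ?normc_ge0 // ltW.
rewrite -mulrA ler_wpM2l ?normr_ge0 // [leRHS]mulrAC.
rewrite -normcX -normcM ler_wpM2l ?normc_ge0 // lef_pV2 //.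
Qed.

(** * Generating functions *)

Lemma cvgn_geometric_sum (R : realType) (y : R[i]) :
  normc y < 1 ->
  (\sum_(1 <= c < M.+1) y ^+ c : R[i]^o) @[M --> \oo] --> (y / (1 - y) : R[i]^o).
Proof.
move=> y1; have y0 := subr1_neq0 _ y y1.
have -> : (fun M => \sum_(1 <= c < M.+1) y ^+ c : R[i]^o) =
    (fun M => (y - y * y ^+ M) * (1 - y)^-1).
  apply/funext; elim=> [|M IHM]; first by rewrite big_nil expr0 mulr1 subrr mul0r.
  by rewrite big_nat_recr //= IHM exprS; field.
have h : (y * y ^+ M : R[i]^o) @[M --> \oo] --> (y * 0 : R[i]^o).
  by apply: cvgMl_tmp; exact: cvgn_exprc.
have {}h : (y - y * y ^+ M : R[i]^o) @[M --> \oo] --> (y - y * 0 : R[i]^o).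
  by apply: cvgB h; exact: cvg_cst.
have {}h : ((y - y * y ^+ M) * (1 - y)^-1 : R[i]^o) @[M --> \oo] -->
    ((y - y * 0) * (1 - y)^-1 : R[i]^o).
  by apply: cvgMr_tmp; exact: h.
rewrite mulr0 subr0 in h; exact: h.
Qed.

Lemma big_nat_recr_cond (V : nmodType) (Q : pred nat) (F : nat -> V) (m n : nat) :
  (m <= n)%N ->
  \sum_(m <= i < n.+1 | Q i) F i =
  \sum_(m <= i < n | Q i) F i + (if Q n then F n else 0).
Proof. by move=> mn; rewrite big_mkcond big_nat_recr //= -big_mkcond. Qed.

Lemma cvgn_sum (R : realType) (u : nat -> nat -> R[i]^o) (l : nat -> R[i]^o)
    (Q : pred nat) (K : nat) :
  (forall i, (0 < i)%N -> u i M @[M --> \oo] --> l i) ->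
  \sum_(1 <= i < K.+1 | Q i) u i M @[M --> \oo] --> \sum_(1 <= i < K.+1 | Q i) l i.
Proof.
move=> ul; elim: K => [|K IHK].
  by under eq_fun do rewrite big_nil; rewrite big_nil; exact: cvg_cst.
have -> : (fun M => \sum_(1 <= i < K.+2 | Q i) u i M) =
    (fun M => \sum_(1 <= i < K.+1 | Q i) u i M) \+
    (fun M => if Q K.+1 then u K.+1 M else 0).
  by apply/funext => M; exact: big_nat_recr_cond.
rewrite (big_nat_recr_cond _ _ _ _ _ (ltn0Sn K)); apply: cvgD; first exact: IHK.
by case: (Q K.+1); [exact: ul | exact: cvg_cst].
Qed.

Lemma cvgn_prod (R : realType) (u : nat -> nat -> R[i]^o) (l : nat -> R[i]^o)
    (K : nat) :
  (forall i, (0 < i)%N -> u i M @[M --> \oo] --> l i) ->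
  (\prod_(1 <= i < K) (u i M : R[i]) : R[i]^o) @[M --> \oo] -->
  (\prod_(1 <= i < K) (l i : R[i]) : R[i]^o).
Proof.
move=> ul; elim: K => [|[|K] IHK].
- by under eq_fun do rewrite big_nil; rewrite big_nil; exact: cvg_cst.
- by under eq_fun do rewrite big_nil; rewrite big_nil; exact: cvg_cst.
have -> : (fun M => \prod_(1 <= i < K.+2) (u i M : R[i]) : R[i]^o) =
    (fun M => (\prod_(1 <= i < K.+1) (u i M : R[i]) : R[i]^o)) \* u K.+1.
  by apply/funext => M; exact: big_nat_recr.
rewrite (big_nat_recr _ _ _ (ltn0Sn K)); apply: cvgM; [exact: IHK | exact: ul].
Qed.

(** The limit of [box_factor] for unbounded multiplicities, when [|q| < 1] and [i > 0]. *)
Definition part_factor {R : realType} (j : nat) (w q : R[i]) (i : nat) : R[i] :=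
  (if (j <= i)%N then w else 1) + q ^+ i / (1 - q ^+ i).

Definition largest_part_series {R : realType} (j : nat) (w q : R[i]) (K : nat) : R[i]^o :=
  \sum_(1 <= L < K.+1 | (j <= L)%N)
     q ^+ L / (1 - q ^+ L) * \prod_(1 <= i < L) part_factor j w q i.

Definition box_sum {F : comPzRingType} (j : nat) (w q : F) (K M : nat) : F :=
  \sum_(s <- box_partitions K M | (j <= largest_part s)%N)
     w ^+ num_missing_ge j s * q ^+ sumn s.

Lemma normcX_lt1 (R : realType) (q : R[i]) (n : nat) :
  (0 < n)%N -> normc q < 1 -> normc (q ^+ n) < 1.
Proof. by move=> n0 q1; rewrite normcX exprn_ilt1 ?normc_ge0 // -lt0n. Qed.

Lemma cvg_box_sum (R : realType) (j : nat) (w q : R[i]) (K : nat) :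
  (0 < j)%N -> normc q < 1 ->
  (box_sum j w q K M : R[i]^o) @[M --> \oo] --> largest_part_series j w q K.
Proof.
move=> j0 q1; rewrite /box_sum; under eq_fun do rewrite box_genfun //.
apply: cvgn_sum => L L0; apply: cvgM.
  by apply: cvgn_geometric_sum; exact: normcX_lt1.
apply: cvgn_prod => i i0; apply: cvgD; first exact: cvg_cst.
by apply: cvgn_geometric_sum; exact: normcX_lt1.
Qed.

(** Below [j] a factor is [1 + q^i / (1 - q^i) = 1 / (1 - q^i)]. *)
Lemma prod_part_factor_small (R : realType) (j : nat) (w q : R[i]) (L : nat) :
  normc q < 1 -> (L < j)%N ->
  \prod_(1 <= i < L.+1) part_factor j w q i = (qpoch q q L)^-1.
Proof.
move=> q1; elim: L => [|L IHL] Lj; first by rewrite /qpoch !big_geq // invr1.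
rewrite big_nat_recr //= IHL; last exact: ltnW.
rewrite qpochS /part_factor leqNgt Lj /= -exprS.
field; rewrite subr1_neq0 ?normcX_lt1 //; exact: qpoch_neq0.
Qed.

(** Induction on [L] starting at [L = j], where the Pochhammer symbol of the prefactor cancels the
    one in the coefficient; afterwards both sides gain the same ratio. *)
Lemma largest_part_term (R : realType) (j : nat) (w q : R[i]) (L : nat) :
  (0 < j)%N -> normc q < 1 -> w != 0 -> qpoch ((w - 1) / w) q j != 0 ->
  (j <= L)%N ->
  q ^+ L / (1 - q ^+ L) * \prod_(1 <= i < L) part_factor j w q i =
  w ^- j / qpoch ((w - 1) / w) q j * (qbin_coef ((w - 1) / w) q L * (w * q) ^+ L).
Proof.
move=> j0 q1 w0 a0; elim: L => [|L IHL]; first by rewrite leqn0 (gtn_eqF j0).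
rewrite leq_eqVlt => /orP[/eqP jL|jL].
  rewrite prod_part_factor_small ?jL // /qbin_coef exprMn.
  rewrite (qpochS _ q q) -exprS.
  have := subr1_neq0 _ _ (normcX_lt1 _ q L.+1 isT q1).
  have := qpoch_neq0 _ q q L q1 q1.
  have := expf_neq0 L.+1 w0; move: a0; rewrite jL.
  by move=> *; field; apply/and4P; split.
have hL := IHL jL; have L0 : (0 < L)%N by apply: leq_trans j0 jL.
have nL := subr1_neq0 _ _ (normcX_lt1 _ q L L0 q1).
have nL1 := subr1_neq0 _ _ (normcX_lt1 _ q L.+1 isT q1).
rewrite -(prednK L0) big_nat_recr ?prednK //=.
have -> : part_factor j w q L = (w * (1 - q ^+ L) + q ^+ L) / (1 - q ^+ L).
  by rewrite /part_factor -ltnS jL; field.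
have -> : qbin_coef ((w - 1) / w) q L.+1 =
    qbin_coef ((w - 1) / w) q L * (1 - (w - 1) / w * q ^+ L) / (1 - q ^+ L.+1).
  by apply: (canRL (mulfK nL1)); exact: qbin_coefS.
set b := \prod_(_ <= _ < _) _ in hL *.
(* The factor of size [L] and the change in [q^L / (1 - q^L)] are collected into one ratio. *)
transitivity ((q ^+ L / (1 - q ^+ L) * b) *
    (q * (w * (1 - q ^+ L) + q ^+ L) / (1 - q ^+ L.+1))).
  by rewrite exprS in nL1 *; field; rewrite nL nL1.
rewrite hL; set c := w ^- j / _.
have -> : w * (1 - q ^+ L) + q ^+ L = w * (1 - (w - 1) / w * q ^+ L) by field.
by rewrite [(w * q) ^+ L.+1]exprS; ring.
Qed.

(** The closed form before the q-binomial theorem sums the series. *)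
Definition genfun_value {R : realType} (j : nat) (w q : R[i]) : R[i]^o :=
  w ^- j / qpoch ((w - 1) / w) q j *
  (qbin_series ((w - 1) / w) q (w * q) - qbin_sum ((w - 1) / w) q (w * q) j).

(** The terms from [j] to [K] form a difference of two partial sums of the q-binomial series, times
    the prefactor. *)
Lemma cvg_largest_part_series (R : realType) (j : nat) (w q : R[i]) :
  (0 < j)%N -> normc q < 1 -> normc (w * q) < 1 -> w != 0 ->
  qpoch ((w - 1) / w) q j != 0 ->
  largest_part_series j w q K @[K --> \oo] --> genfun_value j w q.
Proof.
move=> j0 q1 wq1 w0 a0.
apply: (@cvg_trans _ (w ^- j / qpoch ((w - 1) / w) q j *
    (qbin_sum ((w - 1) / w) q (w * q) K.+1 -
     qbin_sum ((w - 1) / w) q (w * q) j) @[K --> \oo])); last first.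
  apply: cvgMl_tmp; apply: cvgB; last exact: cvg_cst.
  by rewrite (cvg_shiftS (qbin_sum ((w - 1) / w) q (w * q))); exact: cvg_qbin_sum.
apply: near_eq_cvg; near=> K.
have jK : (j <= K.+1)%N by apply: leqW; near: K; exact: nbhs_infty_ge.
rewrite /largest_part_series big_mkcond (big_cat_nat (n := j)) //=.
rewrite [X in _ = X + _]big_nat_cond big1 ?add0r; last first.
  by move=> i; rewrite andbT => /andP[_ ij]; rewrite leqNgt ij.
rewrite /qbin_sum [\sum_(0 <= l < K.+1) _](big_cat_nat (n := j)) //=.
rewrite addrAC subrr add0r mulr_sumr.
rewrite !big_nat; apply: eq_bigr => L /andP[jL _].
by rewrite jL largest_part_term.
Unshelve. all: by end_near. Qed.

(** * Comparison of partition sums with box sums *)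

Lemma big_uniq_subset (V : nmodType) (T : eqType) (X Y : seq T) (F : T -> V) :
  uniq X -> uniq Y -> {subset X <= Y} ->
  \sum_(y <- Y) F y = \sum_(x <- X) F x + \sum_(y <- Y | y \notin X) F y.
Proof.
move=> uX uY XY; rewrite -[X in _ + X]big_filter -big_cat; apply: perm_big.
apply: uniq_perm => // [|y].
  rewrite cat_uniq uX filter_uniq // andbT; apply/hasPn => y.
  by rewrite mem_filter => /andP[].
rewrite mem_cat mem_filter; have [/XY ->|] //= := boolP (y \in X).
Qed.

Lemma ler_sum_subset (R : realType) (T : eqType) (X Y : seq T) (Q : pred T) (F : T -> R) :
  uniq X -> uniq Y -> {in X, forall x, Q x -> x \in Y} -> (forall x, 0 <= F x) ->
  \sum_(x <- X | Q x) F x <= \sum_(y <- Y | Q y) F y.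
Proof.
move=> uX uY XY F0; rewrite -big_filter -[leRHS]big_filter.
rewrite (@big_uniq_subset _ _ [seq x <- X | Q x] [seq y <- Y | Q y]) ?filter_uniq //.
  by rewrite lerDl sumr_ge0.
by move=> x; rewrite !mem_filter => /andP[Qx xX]; rewrite Qx XY.
Qed.

(** The terms of [X] cancel and the triangle inequality handles the rest. Inclusion is asked only
    under [Q], since a box contains the empty partition and [partitions_lt] does not. *)
Lemma normc_sum_diff_le (R : realType) (T : eqType) (X Y : seq T) (Q : pred T)
    (F : T -> R[i]) :
  uniq X -> uniq Y -> {in X, forall x, Q x -> x \in Y} ->
  normc (\sum_(y <- Y | Q y) F y - \sum_(x <- X | Q x) F x) <=
  \sum_(y <- Y | Q y) normc (F y) - \sum_(x <- X | Q x) normc (F x).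
Proof.
move=> uX uY XY.
rewrite -!(big_filter _ Q).
have sXY : {subset [seq x <- X | Q x] <= [seq y <- Y | Q y]}.
  by move=> x; rewrite !mem_filter => /andP[Qx xX]; rewrite Qx XY.
rewrite !(big_uniq_subset _ _ _ _ _ (filter_uniq Q uX) (filter_uniq Q uY) sXY).
rewrite [in leLHS]addrAC subrr add0r [in leRHS]addrAC subrr add0r.
exact: normc_sum.
Qed.

(** Each factor equals [(u (1 - x^k) + x^k) / u > 0]; hence the closed form applies to the majorant
    with [|w|], [|q|]. *)
Lemma qpoch_real_neq0 (R : realType) (u x : R) (j : nat) :
  0 < u -> 0 <= x -> x < 1 ->
  qpoch ((u%:C - 1) / u%:C) x%:C j != 0.
Proof.
move=> u0 x0 x1; rewrite prodf_seq_neq0; apply/allP => k _ /=.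
have -> : 1 - (u%:C - 1) / u%:C * x%:C ^+ k = (1 - (u - 1) / u * x ^+ k)%:C.
  by rewrite !(rmorphB, rmorphM, rmorphXn, fmorphV, rmorph1).
have -> : 1 - (u - 1) / u * x ^+ k = (u * (1 - x ^+ k) + x ^+ k) / u.
  by field; rewrite gt_eqF.
suff h : 0 < (u * (1 - x ^+ k) + x ^+ k) / u.
  by apply/eqP => /complexI /eqP; rewrite gt_eqF.
apply: divr_gt0 => //.
have t0 : 0 <= x ^+ k by exact: exprn_ge0.
have : x ^+ k <= 1 by rewrite exprn_ile1 // ltW.
(* If [x ^+ k = 1], in particular for [k = 0], positivity comes from the second term of the
   numerator, otherwise from the first. *)
rewrite le_eqVlt => /orP[/eqP ->|t1]; first by rewrite subrr mulr0 add0r.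
by apply: ltr_wpDr => //; rewrite mulr_gt0 ?subr_gt0.
Qed.

Definition partition_sum {F : comPzRingType} (j : nat) (w q : F) (N : nat) : F :=
  \sum_(s <- partitions_lt N | (j <= largest_part s)%N)
     w ^+ num_missing_ge j s * q ^+ sumn s.

(** Lets the convergence of complex box sums yield that of the real majorants. *)
Lemma box_sum_normc (R : realType) (j : nat) (w q : R) (K M : nat) :
  0 <= w -> 0 <= q -> box_sum j w q K M = normc (box_sum j w%:C q%:C K M).
Proof.
move=> w0 q0; rewrite -[LHS]normc_real; last first.
  by apply: sumr_ge0 => s _; rewrite mulr_ge0 ?exprn_ge0.
congr normc; rewrite /box_sum raddf_sum; apply: eq_bigr => s _.
by rewrite /= rmorphM !rmorphXn.
Qed.

Lemma partition_sum_sub_box_sum (R : realType) (j K M : nat) (w q : R[i]) :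
  (0 < j)%N ->
  exists N0, forall N, (N0 <= N)%N ->
  normc (partition_sum j w q N - box_sum j w q K M) <=
  partition_sum j (normc w) (normc q) N - box_sum j (normc w) (normc q) K M.
Proof.
move=> j0; have [N0 hN0] := box_sub_partitions_lt j K M j0.
exists N0 => N NN0.
apply: le_trans (normc_sum_diff_le _ _ (box_partitions K M) _ _ _ _ _ _) _.
- exact: box_partitions_uniq.
- exact: partitions_lt_uniq.
- by move=> s sB; exact: hN0.
by under eq_bigr do rewrite normcM !normcX; under [X in _ - X]eq_bigr do rewrite normcM !normcX.
Qed.

Lemma partition_sum_le_box_sum (R : realType) (j N K M : nat) (w q : R) :
  0 <= w -> 0 <= q -> (N <= K)%N -> (N <= M)%N ->
  partition_sum j w q N <= box_sum j w q K M.
Proof.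
move=> w0 q0 NK NM; apply: ler_sum_subset.
- exact: partitions_lt_uniq.
- exact: box_partitions_uniq.
- by move=> s sN _; exact: (partitions_lt_sub_box N).
- by move=> s; rewrite mulr_ge0 ?exprn_ge0.
Qed.

Lemma cvg_partition_sum (R : realType) (j : nat) (w q : R[i]) :
  (0 < j)%N -> normc q < 1 -> normc (w * q) < 1 -> w != 0 ->
  qpoch ((w - 1) / w) q j != 0 ->
  (partition_sum j w q N : R[i]^o) @[N --> \oo] --> genfun_value j w q.
Proof.
move=> j0 q1 wq1 w0 a0.
set u := normc w; set x := normc q; set S := genfun_value j w q.
have u0 : 0 < u.
  by rewrite lt_neqAle normc_ge0 andbT eq_sym; apply/eqP => /eq0_normc/eqP; exact/negP.
have x0 : 0 <= x by exact: normc_ge0.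
have xC1 : normc x%:C < 1 by rewrite normc_real.
have uxC1 : normc (u%:C * x%:C) < 1.
  by rewrite normcM !normc_real ?normc_ge0 // -normcM.
have uC0 : u%:C != 0 by apply/eqP => /complexI /eqP; rewrite gt_eqF.
pose Sbar K := normc (largest_part_series j u%:C x%:C K).
pose sigma := normc (genfun_value j u%:C x%:C).
have Bbar_cvg K : box_sum j u x K M @[M --> \oo] --> Sbar K.
  under eq_fun do rewrite box_sum_normc ?normc_ge0 //.
  by apply: cvg_normc; exact: cvg_box_sum.
have Sbar_cvg : Sbar K @[K --> \oo] --> sigma.
  apply: cvg_normc; apply: cvg_largest_part_series => //.
  exact: qpoch_real_neq0.
(* First [M], then [K] goes to infinity, which bounds every majorant partition sum by [sigma]. *)
have Abar_le_Sbar N K : (N <= K)%N -> partition_sum j u x N <= Sbar K.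
  move=> NK; rewrite -(cvg_lim (@Rhausdorff R) (Bbar_cvg K)).
  apply: limr_ge; first exact: cvgP (Bbar_cvg K).
  near=> M; apply: partition_sum_le_box_sum; rewrite ?normc_ge0 //.
  by near: M; exact: nbhs_infty_ge.
have Abar_le N : partition_sum j u x N <= sigma.
  rewrite -(cvg_lim (@Rhausdorff R) Sbar_cvg).
  apply: limr_ge; first exact: cvgP Sbar_cvg.
  by near=> K; apply: Abar_le_Sbar; near: K; exact: nbhs_infty_ge.
apply/cvg_normcP/cvgrPdist_lt => e e0.
(* Four errors below [e / 4]: from [S] to [T], from [T] to [B], and two for [A - B], which is
   bounded by [sigma - b], the sum of [sigma - Sbar K] and [Sbar K - b], where
   [b = box_sum j u x K M]. *)
have e4 : 0 < e / 4 by rewrite divr_gt0.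
have /cvg_normcP/cvgrPdist_lt/(_ _ e4) HK := cvg_largest_part_series _ _ _ _ j0 q1 wq1 w0 a0.
have /cvgrPdist_lt/(_ _ e4) HSbar := Sbar_cvg.
(* One [K] serves both limits in [K]; then [M] is chosen for this [K], and [N] last. *)
have [K [hK hSbar]] := filter_ex (filterI HK HSbar).
have /cvg_normcP/cvgrPdist_lt/(_ _ e4) HM := cvg_box_sum _ j w q K j0 q1.
have /cvgrPdist_lt/(_ _ e4) HBbar := Bbar_cvg K.
have [M [hM hBbar]] := filter_ex (filterI HM HBbar).
have [N0 hN0] := partition_sum_sub_box_sum _ j K M w q j0.
near=> N; have NN0 : (N0 <= N)%N by near: N; exact: nbhs_infty_ge.
have hN := hN0 N NN0; have hA := Abar_le N.
move: hK hSbar hM hBbar hN hA.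
rewrite !sub0r !normrN !(ger0_norm (normc_ge0 _ _)) -/S -/u -/x.
set A := partition_sum j w q N; set B := box_sum j w q K M.
set T := largest_part_series j w q K.
have t1 : normc (S - A) <= normc (S - T) + normc (T - B) + normc (A - B).
  rewrite -(normcN (A - B)) opprB.
  have -> : S - A = (S - T) + (T - B) + (B - A) by rewrite !addrA !subrK.
  by apply: le_trans (normcD _ _ _) _; rewrite lerD2r normcD.
rewrite !ltr_norml => hK /andP[_ hSbar] hM /andP[_ hBbar] hN hA.
lra.
Unshelve. all: by end_near. Qed.

Theorem theorem2p1 (R : realType) (j : nat) (q w : R[i]) :
  (0 < j)%N -> `|q| < 1 -> `|w * q| < 1 ->
  w != 0 -> qpoch ((w - 1) / w) q j != 0 ->
  let inner (n M : nat) : R[i]^o :=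
    \sum_(0 <= m < M) (P j n m)%:R * w ^+ m * q ^+ n in
  (forall n : nat, cvg (inner n M @[M --> \oo])) /\
  (\sum_(1 <= n < N) lim (inner n M @[M --> \oo])) @[N --> \oo] -->
    (w ^- j / qpoch ((w - 1) / w) q j *
      (qpoch_inf ((w - 1) * q) q / qpoch_inf (w * q) q -
       \sum_(0 <= l < j)
         qpoch ((w - 1) / w) q l / qpoch q q l * (w * q) ^+ l) : R[i]^o).
Proof.
rewrite !norm_lt1 => j0 q1 wq1 w0 a0 inner.
(* The inner sum is stationary: every truncation at [M > n] is the same sum over [partitions n]. *)
have inner_cvg n : inner n M @[M --> \oo] --> inner n n.+1.
  apply: cvg_near_cst; near=> M; rewrite /inner !sum_P_partitions //.
  by near: M; exact: nbhs_infty_gt.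
split=> [n|]; first exact: cvgP (inner_cvg n).
have -> : (fun N => \sum_(1 <= n < N) lim (inner n M @[M --> \oo])) =
    (fun N => partition_sum j w q N : R[i]^o).
  apply/funext => N; rewrite /partition_sum -sum_P_partitions_lt.
  by apply: eq_bigr => n _; apply: cvg_lim (inner_cvg n); exact: norm_hausdorff.
(* The numerator argument [a * z] of the q-binomial theorem at [z = w * q]. *)
have aw : (w - 1) / w * (w * q) = (w - 1) * q by field.
have := cvg_partition_sum _ j w q j0 q1 wq1 w0 a0.
by rewrite /genfun_value (q_binomial _ _ _ _ q1 wq1) aw; exact.
Unshelve. all: by end_near. Qed.
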